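(* Let $n,k\ge0$. The functor $\mathsf{inj}=\mathsf{inj}_{n,k}\colon\underline\Lambda_{n,k}\to\underline\Lambda^{inj}_{n+k+1,k}$ which is defined on coordinate representations by the assignment $$(f_0,f_1,\dots,f_k)\mapsto(f_0,f_1+1,\dots,f_k+k)$$ is an isomorphism (of posets).
   Context: For $n\ge0$, $\Lambda_n$ is the linearly ordered set $\mathbb Z$ equipped with the $\mathbb Z$-action $(\lambda,m)\mapsto\lambda+(n+1)m$. $\underline\Lambda_{n,k}$ is the poset of $\mathbb Z$-equivariant order-preserving maps $\Lambda_k\to\Lambda_n$ with the pointwise order, and $\underline\Lambda^{inj}_{n,k}\subset\underline\Lambda_{n,k}$ is the subposet of those maps whose underlying map $\mathbb Z\to\mathbb Z$ is injective. The coordinate representation of $f\in\underline\Lambda_{n,k}$ is the tuple $(f(0),f(1),\dots,f(k))\in\mathbb Z^{k+1}$; it determines $f$ and identifies $\underline\Lambda_{n,k}$ with the subposet of $\mathbb Z^{k+1}$ (componentwise order) of tuples with $f_0\le f_1\le\dots\le f_k\le f_0+n+1$. *)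

(* Defs.v *)
From HB Require Import structures.
From mathcomp Require Import all_boot all_order all_algebra zify ring.
From mathcomp Require Import boolp.

Set Implicit Arguments.
Unset Strict Implicit.
Unset Printing Implicit Defensive.

Import Order.TTheory GRing.Theory Num.Theory.
Export FunOrder.Exports.
Local Open Scope ring_scope.

(* Lambda_n is [int] with its usual order and the following action of Z. *)
Definition lambda_act (n : nat) (l m : int) : int := l + n.+1%:Z * m.

Definition lambda_equivariant (n k : nat) (f : int -> int) : Prop :=
  forall l m : int, f (lambda_act k l m) = lambda_act n (f l) m.

(* Equivariant order-preserving maps Lambda_k -> Lambda_n.  As in the source,
   [n] (the codomain) comes first. *)
Record lambda_map (n k : nat) := LambdaMap {
  lambda_fun :> int -> int;
  _ : `[< lambda_equivariant n k lambda_fun /\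
          {homo lambda_fun : x y / x <= y} >] }.

HB.instance Definition _ n k := [isSub for @lambda_fun n k].
HB.instance Definition _ n k := [Choice of lambda_map n k by <:].

Fact lambda_display : Order.disp_t. Proof. exact: Order.Disp tt tt. Qed.

(* The order is induced from the pointwise order on [int -> int]
   (see [lambda_leP] below). *)
HB.instance Definition _ n k :=
  [SubChoice_isSubPOrder of lambda_map n k by <: with lambda_display].

Record lambda_inj_map (n k : nat) := LambdaInjMap {
  lambda_inj_val :> lambda_map n k;
  _ : `[< injective (lambda_inj_val : int -> int) >] }.

HB.instance Definition _ n k := [isSub for @lambda_inj_val n k].
HB.instance Definition _ n k := [Choice of lambda_inj_map n k by <:].
HB.instance Definition _ n k :=
  [SubChoice_isSubPOrder of lambda_inj_map n k by <: with lambda_display].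

Lemma lambda_leP n k (f g : lambda_map n k) :
  reflect (forall x, f x <= g x) (f <= g)%O.
Proof. exact: asboolP. Qed.

Lemma lambda_inj_leP n k (f g : lambda_inj_map n k) :
  reflect (forall x, f x <= g x) (f <= g)%O.
Proof. exact: asboolP. Qed.

Definition coord n k (f : lambda_map n k) : 'I_k.+1 -> int := fun i => f i%:Z.

Definition is_coord (n k : nat) (c : 'I_k.+1 -> int) : Prop :=
  (forall i j : 'I_k.+1, (i <= j)%N -> c i <= c j) /\
  c ord_max <= c ord0 + n.+1%:Z.

(* The only candidate for an equivariant map with coordinates [c]:
   x = r + (k+1) q with 0 <= r <= k is sent to c_r + (n+1) q. *)
Definition coord_ext n k (c : 'I_k.+1 -> int) (x : int) : int :=
  lambda_act n (c (inord `|(x %% k.+1)%Z|)) (x %/ k.+1)%Z.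

Lemma lambda_funP n k (f : lambda_map n k) :
  lambda_equivariant n k f /\ {homo f : x y / x <= y}.
Proof. by case: f => f /= /asboolP. Qed.

Lemma coord_extE n k (c : 'I_k.+1 -> int) (i : 'I_k.+1) (q : int) :
  coord_ext n c (i%:Z + k.+1%:Z * q) = lambda_act n (c i) q.
Proof.
have i_small : 0 <= i%:Z < k.+1%:Z by have := ltn_ord i; lia.
rewrite /coord_ext addrC [_ * q]mulrC modzMDl divzMDl // modz_small //.
by rewrite divz_small // addr0 absz_nat inord_val.
Qed.

Lemma int_ord_decomp k (x : int) :
  exists (i : 'I_k.+1) (q : int), x = i%:Z + k.+1%:Z * q.
Proof.
have r0 : 0 <= (x %% k.+1)%Z by exact: modz_ge0.
have rk : (x %% k.+1)%Z < k.+1%:Z by exact: ltz_pmod.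
have r_lt : (`|(x %% k.+1)%Z| < k.+1)%N by lia.
exists (Ordinal r_lt), (x %/ k.+1)%Z => /=.
by rewrite gez0_abs // addrC [k.+1%:Z * _]mulrC -divz_eq.
Qed.

Lemma coord_ext_equivariant n k (c : 'I_k.+1 -> int) :
  lambda_equivariant n k (coord_ext n c).
Proof.
move=> x m; have [i [q ->]] := int_ord_decomp k x.
by rewrite /lambda_act -addrA -mulrDr !coord_extE /lambda_act; ring.
Qed.

Lemma coord_ext_step (r : rel int) n k (c : 'I_k.+1 -> int) :
  (forall x y z, r x y -> r (x + z) (y + z)) ->
  (forall i j : 'I_k.+1, j = i.+1 :> nat -> r (c i) (c j)) ->
  r (c ord_max) (c ord0 + n.+1%:Z) ->
  forall x, r (coord_ext n c x) (coord_ext n c (x + 1)).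
Proof.
move=> rD rc rwrap x; have [i [q ->]] := int_ord_decomp k x.
have [ltik|leki] := ltnP i k.
  have j_lt : (i.+1 < k.+1)%N by [].
  have -> : i%:Z + k.+1%:Z * q + 1 = (Ordinal j_lt)%:Z + k.+1%:Z * q.
    by rewrite /= -[in RHS](addn1 i) PoszD; ring.
  by rewrite !coord_extE; apply: rD; apply: rc.
have -> : i = ord_max by apply/val_inj/eqP; rewrite eqn_leq leki -ltnS ltn_ord.
have -> : (@ord_max k)%:Z + k.+1%:Z * q + 1 = (@ord0 k)%:Z + k.+1%:Z * (q + 1).
  by rewrite /= -(addn1 k) PoszD; ring.
rewrite !coord_extE /lambda_act mulrDr mulr1 [_ * q + _]addrC addrA.
exact: rD.
Qed.

Lemma coord_ext_homo n k (c : 'I_k.+1 -> int) :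
  is_coord n c -> {homo coord_ext n c : x y / x <= y}.
Proof.
move=> [c_homo c_wrap] x y le_xy.
have step := @coord_ext_step <=%R n k c _ _ c_wrap.
have -> : y = x + `|y - x|%:Z by lia.
elim: `|y - x|%N => [|d IHd]; first by rewrite addr0.
apply: (le_trans IHd); rewrite -addn1 PoszD addrA.
apply: step => [a b e|i j def_j].
  by rewrite lerD2r.
by apply: c_homo; lia.
Qed.

Lemma coord_ext_inj n k (c : 'I_k.+1 -> int) :
  (forall i j : 'I_k.+1, j = i.+1 :> nat -> c i < c j) ->
  c ord_max < c ord0 + n.+1%:Z -> injective (coord_ext n c).
Proof.
move=> c_lt c_wrap.
have step := @coord_ext_step <%R n k c _ c_lt c_wrap.
have ext_lt (x y : int) : x < y -> coord_ext n c x < coord_ext n c y.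
  move=> lt_xy; have -> : y = x + (absz (y - x - 1)%R).+1%:Z by lia.
  elim: (absz (y - x - 1)%R) => [|d IHd].
    by apply: step => a b e; rewrite ltrD2r.
  apply: (lt_trans IHd); rewrite -(addn1 d.+1) PoszD addrA.
  by apply: step => a b e; rewrite ltrD2r.
by move=> x y; case: (ltgtP x y) => // /ext_lt; lia.
Qed.

Lemma of_coord_subproof n k (c : 'I_k.+1 -> int) (Hc : is_coord n c) :
  `[< lambda_equivariant n k (coord_ext n c) /\
      {homo coord_ext n c : x y / x <= y} >].
Proof.
by apply: asboolT; split; [exact: coord_ext_equivariant|exact: coord_ext_homo].
Qed.

Definition of_coord n k (c : 'I_k.+1 -> int) (Hc : is_coord n c) :
  lambda_map n k := LambdaMap (of_coord_subproof Hc).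

Lemma coordP n k (f : lambda_map n k) : is_coord n (coord f).
Proof.
have [f_equiv f_homo] := lambda_funP f; split=> [i j le_ij|].
  by apply: f_homo; rewrite lez_nat.
have := f_equiv 0 1; rewrite /lambda_act add0r !mulr1 /coord /= => <-.
by apply: f_homo; rewrite lez_nat.
Qed.

Lemma of_coordK n k (c : 'I_k.+1 -> int) (Hc : is_coord n c) :
  coord (of_coord Hc) = c.
Proof.
apply/funext => i; rewrite /coord /=.
by have := coord_extE n c i 0; rewrite /lambda_act !mulr0 !addr0.
Qed.

Lemma coordK n k (f : lambda_map n k) : of_coord (coordP f) = f.
Proof.
apply/val_inj/funext => x /=; have [i [q ->]] := int_ord_decomp k x.
by rewrite coord_extE /coord; have [-> _] := lambda_funP f.
Qed.

Lemma coord_le n k (f g : lambda_map n k) :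
  (f <= g)%O <-> forall i, coord f i <= coord g i.
Proof.
split=> [/lambda_leP le_fg i|le_fg]; first exact: le_fg.
apply/lambda_leP => x; have [i [q ->]] := int_ord_decomp k x.
have [f_equiv _] := lambda_funP f; have [g_equiv _] := lambda_funP g.
have := f_equiv i q; have := g_equiv i q; rewrite /lambda_act => -> ->.
by rewrite lerD2r; apply: le_fg.
Qed.

Definition inj_coord k (c : 'I_k.+1 -> int) : 'I_k.+1 -> int :=
  fun i => c i + i%:Z.

Lemma inj_coordP n k (c : 'I_k.+1 -> int) :
  is_coord n c -> is_coord (n + k + 1) (inj_coord c).
Proof.
move=> [c_homo c_wrap]; split=> [i j le_ij|]; rewrite /inj_coord.
  by apply: lerD; [exact: c_homo|rewrite lez_nat].
by move: c_wrap => /=; lia.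
Qed.

Lemma inj_subproof n k (f : lambda_map n k) :
  `[< injective (of_coord (inj_coordP (coordP f)) : int -> int) >].
Proof.
have [c_homo c_wrap] := coordP f; apply: asboolT; apply: coord_ext_inj.
  move=> i j def_j; have: coord f i <= coord f j by apply: c_homo; lia.
  by rewrite /inj_coord def_j; lia.
by move: c_wrap; rewrite /inj_coord /=; lia.
Qed.

Definition inj n k (f : lambda_map n k) : lambda_inj_map (n + k + 1) k :=
  LambdaInjMap (inj_subproof f).

Lemma coord_inj n k (f : lambda_map n k) (i : 'I_k.+1) :
  coord (inj f) i = coord f i + i%:Z.
Proof.
by have /(congr1 (fun c => c i)) := of_coordK (inj_coordP (coordP f)).
Qed.

Definition poset_iso d d' (T : porderType d) (T' : porderType d')
    (F : T -> T') : Prop :=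
  {homo F : x y / (x <= y)%O} /\
  exists G : T' -> T,
    [/\ {homo G : x y / (x <= y)%O}, cancel F G & cancel G F].

(* Main.v *)
(* Equivariance gives g(k+1) = g(0) + n + k + 2, so an injective, hence strictly
   increasing, g has gaps g(j) - g(i) >= j - i for i <= j and satisfies
   g(k) - k <= g(0) + n + 1: subtracting i from the i-th coordinate therefore
   inverts inj. *)

From mathcomp Require Import all_boot all_order all_algebra zify.
From mathcomp Require Import boolp.
Require Import Defs.

Set Implicit Arguments.
Unset Strict Implicit.
Unset Printing Implicit Defensive.

Import Order.TTheory GRing.Theory Num.Theory.
Local Open Scope ring_scope.

Lemma lambda_inj_lt n k (g : lambda_inj_map n k) : {homo g : x y / x < y}.
Proof.
have [_ g_homo] := lambda_funP g.
by case: g g_homo => g /= /asboolP g_inj g_homo; apply: inj_homo_lt.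
Qed.

(** Over the integers, each strict increase is by at least 1. *)
Lemma lambda_inj_gap n k (g : lambda_inj_map n k) (x : int) (d : nat) :
  g x + d%:Z <= g (x + d%:Z).
Proof.
elim: d => [|d IHd]; first by rewrite !addr0.
have : g (x + d%:Z) < g (x + d.+1%:Z) by apply: lambda_inj_lt; lia.
by move: IHd; lia.
Qed.

Definition uninj_coord k (c : 'I_k.+1 -> int) : 'I_k.+1 -> int :=
  fun i => c i - i%:Z.

Lemma uninj_coordP n k (g : lambda_inj_map (n + k + 1) k) :
  is_coord n (uninj_coord (coord g)).
Proof.
split=> [i j le_ij|]; rewrite /uninj_coord /coord.
  (* The truncated difference [j - i] is exact here by [le_ij]. *)
  have := lambda_inj_gap g i%:Z (j - i); rewrite -PoszD subnKC //.
  by lia.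
have [g_equiv _] := lambda_funP g.
have g_wrap : g k.+1%:Z = g 0%:Z + (n + k + 1).+1%:Z.
  by have := g_equiv 0 1; rewrite /lambda_act add0r !mulr1.
(* Strictness lowers the bound [g 0 + n + k + 2] by 1; subtracting [k] then leaves exactly
   [g 0 + n + 1]. *)
have : g k%:Z < g k.+1%:Z by apply: lambda_inj_lt; lia.
by rewrite g_wrap /=; lia.
Qed.

Definition uninj n k (g : lambda_inj_map (n + k + 1) k) : lambda_map n k :=
  of_coord (uninj_coordP g).

Lemma coord_uninj n k (g : lambda_inj_map (n + k + 1) k) (i : 'I_k.+1) :
  coord (uninj g) i = coord g i - i%:Z.
Proof. by rewrite of_coordK. Qed.

(** Coordinates reflect the order, so antisymmetry applies. *)
Lemma eq_coord n k (f g : lambda_map n k) : coord f =1 coord g -> f = g.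
Proof.
by move=> eq_fg; apply: le_anti; apply/andP; split;
  apply/coord_le => i; rewrite eq_fg.
Qed.

Theorem proposition3p39 (n k : nat) : poset_iso (@inj n k).
Proof.
split=> [f g /coord_le le_fg|].
  (* The order on injective maps is induced from [lambda_map], so it too is tested on
     coordinates. *)
  by apply/coord_le => i; rewrite !coord_inj lerD2r.
exists (@uninj n k); split=> [f g /coord_le le_fg|f|g].
- by apply/coord_le => i; rewrite !coord_uninj lerD2r.
- by apply: eq_coord => i; rewrite coord_uninj coord_inj addrK.
- by apply/val_inj/eq_coord => i; rewrite coord_inj coord_uninj subrK.
Qed.
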